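(* If $p$ is a $0$-maximal polynomial of degree $n\ge 2$, then $d(p)=|p|_0$.
   Context: $Z(f)$ denotes the zero set of $f$. $S(n,0)$ is the set of monic complex polynomials $p$ of degree $n\ge 2$ having all their zeros in the closed unit disk and satisfying $p(0)=0$. For $p\in S(n,0)$ let $|p|_0=\min_{w\in Z(p')}|w|$ and $d(p)=\max_{z\in Z(p)}\min_{w\in Z(p')}|z-w|$. A polynomial $p\in S(n,0)$ is called $0$-maximal (of degree $n$) if $|p|_0\ge|q|_0$ for every $q\in S(n,0)$. *)

(* Defs.v *)
From HB Require Import structures.
From mathcomp Require Import all_boot all_order all_algebra.
From mathcomp Require Import complex.
From mathcomp Require Import boolp classical_sets functions cardinality reals.

Set Implicit Arguments.
Unset Strict Implicit.
Unset Printing Implicit Defensive.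

Import Order.TTheory GRing.Theory Num.Theory.
Import Normc.

Local Open Scope ring_scope.
Local Open Scope complex_scope.
Local Open Scope classical_set_scope.

(* The least (greatest) element of A; the default 0 is returned only when A
   has no such element, which never happens for a finite nonempty A, see
   [set_minP] and [set_maxP]. *)
Definition set_min (R : realType) (A : set R) : R := xget 0 (A `&` lbound A).
Definition set_max (R : realType) (A : set R) : R := xget 0 (A `&` ubound A).

Definition zeros (R : realType) (f : {poly R[i]}) : set R[i] :=
  [set z | root f z].

Definition S_n0 (R : realType) (n : nat) : set {poly R[i]} :=
  [set p | [/\ p \is monic, size p = n.+1,
    forall z, zeros p z -> normc z <= 1 & p.[0] = 0]].

Definition min_crit (R : realType) (p : {poly R[i]}) : R :=
  set_min [set normc w | w in zeros p^`()].

Definition crit_dist (R : realType) (p : {poly R[i]}) : R :=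
  set_max [set set_min [set normc (z - w) | w in zeros p^`()]
          | z in zeros p].

Definition zero_maximal (R : realType) (n : nat) (p : {poly R[i]}) : Prop :=
  S_n0 n p /\ forall q : {poly R[i]}, S_n0 n q -> min_crit q <= min_crit p.

Lemma set_minP (R : realType) (A : set R) : finite_set A -> A !=set0 ->
  A (set_min A) /\ lbound A (set_min A).
Proof.
move=> /finite_seqP[s ->] [a /= sa]; apply: (@xgetPex _ 0 (_ `&` _)).
elim: s a sa => // x s IHs a _; have [[b sb]|s0] := pselect (exists b, b \in s);
  last first.
  exists x; split=> [|y] /=; first exact: mem_head.
  by rewrite inE => /orP[/eqP->//|sy]; case: s0; exists y.
have [m [sm ms]] := IHs b sb.
have [lexm|ltmx] := leP x m.
  exists x; split=> [|y] /=; first exact: mem_head.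
  by rewrite inE => /orP[/eqP->//|/ms]; apply: le_trans.
exists m; split=> [|y] /=; first by rewrite inE [m \in s]sm orbT.
by rewrite inE => /orP[/eqP->|/ms//]; apply: ltW.
Qed.

Lemma set_maxP (R : realType) (A : set R) : finite_set A -> A !=set0 ->
  A (set_max A) /\ ubound A (set_max A).
Proof.
move=> Afin [a Aa]; apply: (@xgetPex _ 0 (_ `&` _)).
have [] := @set_minP R [set - x | x in A] (finite_image _ Afin).
  by exists (- a), a.
case=> m Am <- mA; exists m; split=> // x Ax.
by rewrite -lerN2; apply: mA; exists x.
Qed.

Lemma finite_zeros (R : realType) (f : {poly R[i]}) :
  f != 0 -> finite_set (zeros f).
Proof.
move=> f0; have [s fE] := closed_field_poly_normal f.
apply: (@sub_finite_set _ _ [set` s]); last exact: finite_seq.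
move=> z; rewrite /zeros /= fE rootZ ?lead_coef_eq0//.
by rewrite root_prod_XsubC.
Qed.

Lemma zeros_nonempty (R : realType) (f : {poly R[i]}) :
  (1 < size f)%N -> zeros f !=set0.
Proof.
move=> f1; have /closed_rootP[z fz] : size f != 1%N by rewrite gtn_eqF.
by exists z.
Qed.

Lemma size_deriv_S_n0 (R : realType) (n : nat) (p : {poly R[i]}) :
  S_n0 n p -> size p^`() = n.
Proof.
case=> pm sp _ _; case: n sp => [|n] sp.
  by rewrite (size1_polyC (eq_leq sp)) derivC size_poly0.
apply/eqP; rewrite eqn_leq -ltnS -sp lt_size_deriv -?size_poly_gt0 ?sp//=.
rewrite ltnNge; apply/negP => /leq_sizeP/(_ n (leqnn n))/eqP.
have pn : p`_n.+1 = 1 by move/monicP: pm; rewrite lead_coefE sp.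
by rewrite coef_deriv pn pnatr_eq0.
Qed.

(* Main.v *)
(* Put r = |p|_0.  Since |p'(0)| is the product of the moduli of the nonzero
   zeros, r^(n-1) <= prod |w| = |p'(0)| / n <= 1/n over the critical points w,
   while the competitor X^n - X has |X^n - X|_0^(n-1) = 1/n.  So for maximal p
   all these are equalities: every critical point has modulus r, and every
   nonzero zero has modulus 1.

   Let z <> 0 be a zero that is not critical.  Evaluating z p''(z) / p'(z) in
   two ways gives sum_w z / (z - w) = 2 sum_x z / (z - x), with x over the other
   zeros; Re (z / (z - x)) is 1 for x = 0 and 1/2 for |x| = 1, so the real part
   is n.  If |z - w| > r for all w, each term on the left has real part
   (1 + (1 - r^2) / |z - w|^2) / 2 < 1 / (2 r^2), so n < (n - 1) / (2 r^2).
   This contradicts r^(n-1) = 1/n, because n^2 (n-1)^(n-1) <= (2n)^(n-1). *)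
Require Import Defs.
From mathcomp Require Import all_boot all_order all_algebra.
From mathcomp Require Import complex.
From mathcomp Require Import boolp classical_sets cardinality.
From mathcomp Require Import reals.
From mathcomp Require Import zify ring.

Import Order.TTheory GRing.Theory Num.Theory.
Import Normc.

Local Open Scope ring_scope.
Local Open Scope complex_scope.

(** * Logarithmic derivatives of split polynomials *)

Lemma horner_deriv_prod_XsubC (F : fieldType) (s : seq F) (z : F) :
  z \notin s ->
  (\prod_(x <- s) ('X - x%:P))^`().[z] =
    (\prod_(x <- s) ('X - x%:P)).[z] * \sum_(x <- s) (z - x)^-1.
Proof.
elim: s => [|x s IHs]; first by rewrite !big_nil derivC hornerC mulr0.
rewrite inE negb_or => /andP[zx zs].
rewrite !big_cons derivM derivXsubC mul1r !(hornerE, hornerD) IHs//.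
field; by rewrite subr_eq0.
Qed.

(** Both sides equal p''(z) / p'(z): for p = (X - z) g one has p'(z) = g(z) and p''(z) = 2 g'(z). As
    p'(z) is nonzero, z lies in neither [s] nor [u]. *)
Lemma sum_inv_sub_critical (F : fieldType) (p : {poly F}) (z c : F) (s u : seq F) :
  p = ('X - z%:P) * \prod_(x <- u) ('X - x%:P) ->
  p^`() = c *: \prod_(w <- s) ('X - w%:P) -> ~~ root p^`() z ->
  \sum_(w <- s) (z - w)^-1 = 2 * \sum_(x <- u) (z - x)^-1.
Proof.
set g := \prod_(x <- u) _ => pE p'E; rewrite rootE => p'z0.
have p'z : p^`().[z] = g.[z].
  by rewrite pE derivM derivXsubC !(hornerE, hornerD) subrr mul0r addr0.
have zu : z \notin u by rewrite -root_prod_XsubC rootE -/g -p'z.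
have zs : z \notin s.
  rewrite -root_prod_XsubC rootE; apply: contra p'z0 => /eqP z0.
  by rewrite p'E hornerZ z0 mulr0.
apply: (mulfI p'z0).
rewrite [in LHS]p'E hornerZ -mulrA -horner_deriv_prod_XsubC// -hornerZ -derivZ -p'E.
rewrite p'z mulrCA -horner_deriv_prod_XsubC// -/g pE.
rewrite derivM derivXsubC mul1r derivD derivM derivXsubC mul1r.
rewrite !hornerD hornerM hornerXsubC subrr /=; ring.
Qed.

(** * Inequalities for the extremal radius *)

Lemma leq_succ_sqr_expn (m : nat) :
  (0 < m -> m.+1 ^ 2 * m ^ m <= (2 * m.+1) ^ m)%N.
Proof.
(* The values 1 and 2 are equality cases, settled by computation. From 3 on, [H1] times [H2] is
   twice the claim; [H1] fails at k = 2. *)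
case: m => [|[|[|m]]]// _; set k := m.+3.
have H1 : (k.+1 ^ 2 <= 2 ^ k.+1)%N.
  rewrite /k; elim: m {k} => // m IHm; rewrite (expnS 2).
  have : (m.+1.+4 ^ 2 <= 2 * m.+4 ^ 2)%N by rewrite !expnS !expn0; nia.
  by move=> /leq_trans; apply; rewrite leq_mul2l.
have H2 : (2 * k ^ k <= k.+1 ^ k)%N.
  (* The first two binomial terms of (k + 1)^k are both k^k. *)
  rewrite -[k.+1]addn1 expnDn 2!big_ord_recl /= subn0 !exp1n !muln1 bin0 mul1n.
  rewrite bin1 /bump /= add1n subSS subn0 -expnS.
  by rewrite mul2n -addnn leq_add2l leq_addr.
rewrite expnMn -(leq_pmul2l (isT : 0 < 2)%N) mulnCA.
rewrite [X in (_ <= X)%N]mulnA -expnS.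
exact: leq_mul.
Qed.

(** Compare m-th powers: r^(2m) = (m + 1)^-2 turns the negated claim into the negation of
    [leq_succ_sqr_expn]. *)
Lemma le_radius_sqr (R : realFieldType) (m : nat) (r : R) : (0 < m)%N ->
  r ^+ m = m.+1%:R^-1 -> m%:R <= 2 * m.+1%:R * r ^+ 2.
Proof.
move=> m0 rm; rewrite leNgt; apply/negP => rlt.
have : (2 * m.+1%:R * r ^+ 2) ^+ m < m%:R ^+ m.
  by rewrite ltrXn2r -?lt0n// mulr_ge0 ?sqr_ge0// mulr_ge0.
rewrite exprMn -exprM mulnC exprM rm -(natrM _ 2) -!natrX exprVn -natrX.
rewrite ltr_pdivrMr ?ltr0n ?expn_gt0// -natrM ltr_nat [(m ^ m * _)%N]mulnC ltnNge.
by rewrite leq_succ_sqr_expn.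
Qed.

(** The other factors multiply to at most 1, so the product is at most each single factor. *)
Lemma prod_ge1_eq1 (R : realFieldType) (I : eqType) (s : seq I) (F : I -> R) :
  (forall i, i \in s -> 0 <= F i <= 1) -> 1 <= \prod_(i <- s) F i ->
  forall i, i \in s -> F i = 1.
Proof.
move=> F01 prod1 i si.
have /andP[Fi0 Fi1] := F01 _ si.
apply/eqP; rewrite eq_le Fi1 /=; apply: (le_trans prod1).
rewrite (big_rem i si) /= ler_piMr// big_seq_cond prodr_ile1// => j.
by rewrite andbT => /mem_rem/F01.
Qed.

(** * Moduli and real parts *)

Section Modulus.
Context {R : realType}.
Implicit Types z w : R[i].

Lemma normc_ge0 z : 0 <= normc z.
Proof. by case: z => a b; rewrite sqrtr_ge0. Qed.

Lemma sqr_normc_ReIm z : normc z ^+ 2 = complex.Re z ^+ 2 + complex.Im z ^+ 2.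
Proof. by case: z => a b; rewrite sqr_sqrtr// addr_ge0 ?sqr_ge0. Qed.

Lemma normcX z n : normc (z ^+ n) = normc z ^+ n.
Proof. by elim: n => [|n IHn]; rewrite ?normc1// !exprS normcM IHn. Qed.

Lemma normc_nat n : normc (n%:R : R[i]) = n%:R.
Proof. by rewrite [LHS](normcMn (1 : R[i])) normc1. Qed.

Lemma normc_prod (I : Type) (s : seq I) (F : I -> R[i]) :
  normc (\prod_(i <- s) F i) = \prod_(i <- s) normc (F i).
Proof. by apply: big_morph; [exact: normcM | exact: normc1]. Qed.

Lemma normc_horner0_prod_XsubC (s : seq R[i]) :
  normc (\prod_(x <- s) ('X - x%:P)).[0] = \prod_(x <- s) normc x.
Proof.
rewrite horner_prod normc_prod; apply: eq_bigr => x _.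
by rewrite hornerXsubC sub0r normcN.
Qed.

Lemma Re_sum (I : Type) (s : seq I) (F : I -> R[i]) :
  complex.Re (\sum_(i <- s) F i) = \sum_(i <- s) complex.Re (F i).
Proof. by apply: big_morph => // -[a b] [c d]. Qed.

(** Divide 2 Re (z conj(z - w)) = |z|^2 + |z - w|^2 - |w|^2 by 2 |z - w|^2. *)
Lemma Re_div_sub z w : normc z = 1 -> z != w ->
  complex.Re (z / (z - w)) = (1 + (1 - normc w ^+ 2) / normc (z - w) ^+ 2) / 2.
Proof.
move=> z1 zw.
have d0 : normc (z - w) ^+ 2 != 0.
  by rewrite sqrf_eq0; apply: contra zw => /eqP/eq0_normc/eqP; rewrite subr_eq0.
have := sqr_normc_ReIm z; rewrite z1 expr1n.
move: d0; rewrite !sqr_normc_ReIm; case: z w {z1 zw} => a b [c d] /= d0 ab.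
by rewrite {2}ab; field.
Qed.

End Modulus.

(** * Critical points of 0-maximal polynomials *)

Section CriticalModulus.
Context {R : realType}.
Implicit Type p : {poly R[i]}.

Lemma monic_splits p : p \is monic ->
  exists s : seq R[i], p = \prod_(x <- s) ('X - x%:P).
Proof.
move=> /monicP pm; have [s] := closed_field_poly_normal p.
by rewrite pm scale1r; exists s.
Qed.

Lemma deriv_splits m p : S_n0 m.+2 p -> exists2 s : seq R[i],
  p^`() = m.+2%:R *: \prod_(w <- s) ('X - w%:P) & size s = m.+1.
Proof.
move=> Sp; have sp' := size_deriv_S_n0 Sp; case: Sp => pm sp _ _.
have n0 : m.+2%:R != 0 :> R[i] by rewrite pnatr_eq0.
have [s] := closed_field_poly_normal p^`().
have -> : lead_coef p^`() = m.+2%:R.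
  by rewrite lead_coefE sp' coef_deriv; move/monicP: pm; rewrite lead_coefE sp => ->.
move=> p'E; exists s => //.
by move: sp'; rewrite p'E size_scale// size_prod_XsubC => -[].
Qed.

Lemma min_dist_critP n p (z : R[i]) : (2 <= n)%N -> S_n0 n p ->
  let d := set_min [set normc (z - w) | w in zeros p^`()]%classic in
  (exists2 w, root p^`() w & normc (z - w) = d) /\
  forall w, root p^`() w -> d <= normc (z - w).
Proof.
move=> n2 /size_deriv_S_n0 sp' d.
have [||[w /= w0 wd] dle] :=
    @set_minP R [set normc (z - w) | w in zeros p^`()]%classic.
- by apply/finite_image/finite_zeros; rewrite -size_poly_gt0 sp' ltnW.
- have [w w0] : (zeros p^`() !=set0)%classic by apply: zeros_nonempty; rewrite sp'.
  by exists (normc (z - w)), w.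
by split; [exists w | move=> v v0; apply: dle; exists v].
Qed.

(** This makes |p|_0 the term of d(p) at the zero 0, so [min_dist_critP] serves both quantities. *)
Lemma min_crit_dist0 p :
  min_crit p = set_min [set normc (0 - w) | w in zeros p^`()]%classic.
Proof.
by congr set_min; apply: eq_imagel => w _; rewrite sub0r normcN.
Qed.

Lemma min_crit_ge0 n p : (2 <= n)%N -> S_n0 n p -> 0 <= min_crit p.
Proof.
move=> n2 Sp; have [[w _]] := min_dist_critP _ _ 0 n2 Sp.
by rewrite -min_crit_dist0 => <- _; apply: normc_ge0.
Qed.

Lemma S_n0_XnsubX n : (2 <= n)%N -> S_n0 n ('X^n - 'X : {poly R[i]}).
Proof.
move=> n2.
have sq : size ('X^n - 'X : {poly R[i]}) = n.+1.
  by rewrite size_polyDl size_polyXn// size_polyN size_polyX.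
split=> //.
- by rewrite monicE lead_coefDl ?lead_coefXn// size_polyN size_polyX size_polyXn.
- move=> z; rewrite /zeros /= rootE !hornerE subr_eq0 => /eqP zn.
  have /eqP := congr1 (@normc R) zn; rewrite normcX; apply: contraTT.
  rewrite -ltNge => z1; rewrite gt_eqF// -[ltLHS]expr1 ltr_eXn2l//.
by rewrite !hornerE expr0n subr0; case: n n2 {sq}.
Qed.

Lemma min_crit_XnsubX n : (2 <= n)%N ->
  min_crit ('X^n - 'X : {poly R[i]}) ^+ n.-1 = n%:R^-1.
Proof.
move=> n2; have n0 : n%:R != 0 :> R by rewrite pnatr_eq0 -lt0n ltnW.
have [[w]] := min_dist_critP _ _ 0 n2 (S_n0_XnsubX _ n2).
rewrite -min_crit_dist0 sub0r normcN => w0 <- _.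
move: w0; rewrite rootE derivB derivXn derivX !hornerE hornerMn hornerXn.
rewrite subr_eq0 => /eqP/(congr1 (@normc R)).
rewrite normcMn normc1 normcX => wn.
by apply: (mulIf n0); rewrite mulr_natr wn mulVf.
Qed.

Lemma zero_maximal_modulus m p : zero_maximal m.+2 p ->
  [/\ min_crit p ^+ m.+1 = m.+2%:R^-1,
      forall w, root p^`() w -> normc w = min_crit p &
      exists t : seq R[i], [/\ p = 'X * \prod_(x <- t) ('X - x%:P),
        size t = m.+1 & forall x, x \in t -> normc x = 1]].
Proof.
move=> [Sp pmax].
have [_ rho_le] := min_dist_critP _ _ 0 (isT : 2 <= m.+2)%N Sp.
have rho_ge0 : 0 <= min_crit p by apply: min_crit_ge0 Sp.
move: rho_ge0 rho_le; rewrite -min_crit_dist0; set rho := min_crit p => rho_ge0 rho_le.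
have {}rho_le w : root p^`() w -> rho <= normc w.
  by move/rho_le; rewrite sub0r normcN.
have rhom : m.+2%:R^-1 <= rho ^+ m.+1.
  rewrite -(min_crit_XnsubX _ (isT : 2 <= m.+2)%N) lerXn2r ?nnegrE//.
    exact/min_crit_ge0/S_n0_XnsubX.
  exact: pmax _ (S_n0_XnsubX _ _).
have n0 : m.+2%:R != 0 :> R by rewrite pnatr_eq0.
have rho_gt0 : 0 < rho.
  rewrite lt_neqAle rho_ge0 andbT eq_sym; apply: contraTneq rhom => ->.
  by rewrite expr0n/= -ltNge invr_gt0 ltr0n.
case: (Sp) => pm sp ple1 p0.
have [t0 pE0] := monic_splits _ pm.
have t00 : 0 \in t0 by rewrite -root_prod_XsubC -pE0 rootE p0.
(* Only one copy of 0 is removed: [t] may still contain 0 until its moduli are shown to be 1. *)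
have [t pE] : exists t : seq R[i], p = 'X * \prod_(x <- t) ('X - x%:P).
  by exists (rem 0 t0); rewrite pE0 (big_rem 0 t00)/= subr0.
have st : size t = m.+1.
  move: sp; rewrite pE size_monicM ?monicX ?monic_neq0 ?monic_prod_XsubC//.
  by rewrite size_polyX size_prod_XsubC => -[].
have [s p'E ss] := deriv_splits _ _ Sp.
have rts w : root p^`() w = (w \in s) by rewrite p'E rootZ ?pnatr_eq0// root_prod_XsubC.
(* Both sides are |p'(0)|, read off from the critical points and from p = X q with p'(0) = q(0). *)
have prodE : m.+2%:R * \prod_(w <- s) normc w = \prod_(x <- t) normc x.
  rewrite -!normc_horner0_prod_XsubC -normc_nat -normcM -hornerZ -p'E pE.
  by rewrite derivM derivX !hornerE.
have t_le1 x : x \in t -> 0 <= normc x <= 1.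
  move=> xt; rewrite normc_ge0 ple1// /zeros /= pE rootM root_prod_XsubC xt.
  exact: orbT.
have s_le1 w : w \in s -> 0 <= rho / normc w <= 1.
  rewrite -rts => /rho_le wle; rewrite divr_ge0 ?normc_ge0//=.
  by rewrite ler_pdivrMr ?mul1r// (lt_le_trans rho_gt0).
have rhoE : rho ^+ m.+1 = \prod_(w <- s) (rho / normc w) * \prod_(w <- s) normc w.
  have -> : rho ^+ m.+1 = \prod_(w <- s) rho.
    by rewrite big_const_seq count_predT iter_mulr_1 ss.
  rewrite -big_split /=; apply: eq_big_seq => w.
  by rewrite -rts => /rho_le wle; rewrite divfK// gt_eqF// (lt_le_trans rho_gt0).
have prodt_le1 : \prod_(x <- t) normc x <= 1.
  by rewrite big_seq_cond prodr_ile1// => x /andP[/t_le1].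
have prods_le1 : \prod_(w <- s) (rho / normc w) <= 1.
  by rewrite big_seq_cond prodr_ile1// => x /andP[/s_le1].
have A0 : 0 <= \prod_(w <- s) (rho / normc w).
  by rewrite big_seq_cond prodr_ge0// => x /andP[/s_le1/andP[]].
have T0 : 0 <= \prod_(x <- t) normc x by apply: prodr_ge0 => x _; exact: normc_ge0.
(* This product is n rho^(n-1), at least 1 by comparison with X^n - X. Both of its factors are at
   most 1, hence both equal 1. *)
have AT1 : 1 <= \prod_(w <- s) (rho / normc w) * \prod_(x <- t) normc x.
  by rewrite -prodE mulrCA -rhoE -ler_pdivrMl ?mulr1// ltr0n.
have T1 : 1 <= \prod_(x <- t) normc x by apply: (le_trans AT1); rewrite ler_piMl.
have A1 : 1 <= \prod_(w <- s) (rho / normc w).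
  by apply: (le_trans AT1); rewrite ler_piMr.
split.
- apply: (mulfI n0); rewrite rhoE mulrCA prodE mulfV//.
  by apply/eqP; rewrite eq_le AT1 andbT mulr_ile1.
- move=> w w0; have wgt0 : 0 < normc w by apply: (lt_le_trans rho_gt0); exact: rho_le.
  have /(_ w) := prod_ge1_eq1 _ _ _ _ s_le1 A1; rewrite -rts => /(_ w0).
  by move/(congr1 ( *%R^~ (normc w))); rewrite divfK ?gt_eqF// mul1r.
- by exists t; split=> //; exact: prod_ge1_eq1 t_le1 T1.
Qed.

Lemma near_critical_point m p (z : R[i]) : zero_maximal m.+2 p ->
  root p z -> z != 0 ->
  exists2 w, root p^`() w & normc (z - w) <= min_crit p.
Proof.
move=> pmax pz z0; apply: contrapT => no_w.
have {}no_w w : root p^`() w -> min_crit p < normc (z - w).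
  by move=> w0; rewrite ltNge; apply/negP => wle; apply: no_w; exists w.
have [rhom critE [t [pE st t1]]] := zero_maximal_modulus _ _ pmax.
move: rhom critE no_w; set rho := min_crit p => rhom critE no_w.
have Sp : S_n0 m.+2 p by case: pmax.
have rho_ge0 : 0 <= rho by apply: min_crit_ge0 Sp.
have rhom_gt0 : 0 < rho ^+ m.+1 by rewrite rhom invr_gt0.
have rho_gt0 : 0 < rho.
  rewrite lt_neqAle rho_ge0 andbT eq_sym; apply: contraTneq rhom_gt0 => ->.
  by rewrite expr0n ltxx.
have rho_lt1 : rho ^+ 2 < 1.
  by rewrite expr_lt1// -(@expr_lt1 _ m.+1)// rhom invf_lt1// ltr1n.
(* A critical z would itself be a critical point at distance 0. *)
have p'z : ~~ root p^`() z.
  by apply/negP => /no_w; rewrite subrr normc0 => /lt_geF; rewrite rho_ge0.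
have zt : z \in t.
  move: pz; rewrite pE rootM root_prod_XsubC => /orP[|//].
  by rewrite rootX (negPf z0).
have z1 := t1 _ zt.
have pE' : p = ('X - z%:P) * \prod_(x <- 0 :: rem z t) ('X - x%:P).
  by rewrite pE (big_rem z zt) big_cons /= subr0 mulrCA.
have [s p'E ss] := deriv_splits _ _ Sp.
have sN w : w \in s -> root p^`() w.
  by move=> ws; rewrite p'E rootZ ?pnatr_eq0// root_prod_XsubC.
have zu : z \notin 0 :: rem z t.
  move: p'z; apply: contra => zu; rewrite pE' derivM derivXsubC mul1r rootE.
  rewrite hornerD hornerM hornerXsubC subrr mul0r addr0.
  by rewrite -rootE root_prod_XsubC.
have := sum_inv_sub_critical _ _ _ _ _ _ pE' p'E p'z.
move=> /(congr1 (fun x => complex.Re (z * x))); rewrite mulrCA mulr_natl.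
rewrite !mulr_sumr.
(* The zero 0 contributes 1 and each of the m unimodular zeros in [rem z t] contributes 1/2;
   doubling gives m + 2. *)
have -> : complex.Re ((\sum_(x <- 0 :: rem z t) z * (z - x)^-1) *+ 2) = m.+2%:R.
  have -> (x : R[i]) : complex.Re (x *+ 2) = 2 * complex.Re x.
    by case: x => a b; rewrite !mulr2n mulrDl mul1r.
  rewrite Re_sum big_cons subr0 mulfV// (eq_big_seq (fun=> 2^-1)).
    rewrite big_const_seq count_predT size_rem// st iter_addr_0 /=.
    by rewrite -[2^-1 *+ m]mulr_natr -[m.+2]addn2 natrD; field.
  move=> x xt; rewrite Re_div_sub//; last first.
    by apply: contraNneq zu => {1}->; rewrite inE xt orbT.
  by rewrite t1 ?(mem_rem xt)// expr1n subrr mul0r addr0 mul1r.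
rewrite Re_sum => sumE.
have Re_lt w : w \in s -> complex.Re (z * (z - w)^-1) < (2 * rho ^+ 2)^-1.
  move=> /sN w0; have rho_lt := no_w _ w0.
  rewrite Re_div_sub// ?(critE _ w0); last by apply: contraNneq p'z => ->.
  have d_gt0 : 0 < normc (z - w) ^+ 2 by rewrite exprn_gt0// (lt_trans rho_gt0).
  have rho2_gt0 : 0 < rho ^+ 2 by rewrite exprn_gt0.
  have rho2_lt : rho ^+ 2 < normc (z - w) ^+ 2 by rewrite ltrXn2r.
  (* The bound is the value of the real part at distance rho; since rho < 1, that value strictly
     decreases with the distance. *)
  have -> : (2 * rho ^+ 2)^-1 = (1 + (1 - rho ^+ 2) / rho ^+ 2) / 2.
    by field; rewrite gt_eqF.
  by rewrite ltr_pM2r ?invr_gt0// ltrD2l ltr_pM2l ?subr_gt0// ltf_pV2.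
have : \sum_(w <- s) complex.Re (z * (z - w)^-1) < \sum_(w <- s) (2 * rho ^+ 2)^-1.
  rewrite big_seq [ltRHS]big_seq; apply: ltr_sum => //.
  (* Strictness of the summed inequality needs a critical point, and [s] has m + 1 entries. *)
  by case: s ss {p'E sN sumE Re_lt} => //= w s _; rewrite mem_head.
rewrite sumE big_const_seq count_predT ss iter_addr_0 -[ltRHS]mulr_natl.
rewrite ltr_pdivlMr ?mulr_gt0 ?exprn_gt0// ltNge.
by rewrite mulrCA mulrA le_radius_sqr.
Qed.

End CriticalModulus.

Theorem corollary2p1 (R : realType) (n : nat) (p : {poly R[i]}) :
  (2 <= n)%N -> zero_maximal n p -> crit_dist p = min_crit p.
Proof.
case: n => [|[|m]]// n2 pmax; have Sp : S_n0 m.+2 p by case: pmax.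
have p0 : root p 0 by rewrite rootE; case: Sp => _ _ _ ->.
have pn0 : p != 0 by rewrite monic_neq0//; case: Sp.
rewrite /crit_dist.
have [||[z zp <-] dmax] := @set_maxP R
    [set set_min [set normc (z - w) | w in zeros p^`()] | z in zeros p]%classic.
- exact/finite_image/finite_zeros.
- by exists (set_min [set normc (0 - w) | w in zeros p^`()]%classic); exists 0.
have min_dist0 := min_crit_dist0 p.
(* The zero 0 gives d(p) >= |p|_0. For the converse, z attains d(p): it is either 0 or covered by
   [near_critical_point]. *)
apply/eqP; rewrite eq_le; apply/andP; split; last first.
  by rewrite min_dist0; apply: dmax; exists 0.
have [->|z0] := eqVneq z 0; first by rewrite min_dist0.
have [w w0 wle] := near_critical_point _ _ _ pmax zp z0.
apply: le_trans wle; exact: (min_dist_critP _ _ z n2 Sp).2.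
Qed.
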